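(* Let $N\ge1$, $h,l>0$, $\theta_1,\theta_2,\theta_3>0$, $(\alpha,\beta)\in\mathbb R^2\setminus\{(0,0)\}$, and let $T_N$ be the transmission probability of the $N$-resonator system described in the context, with type-I vertex conditions. Put $A=\frac{\theta_1^2+\theta_2^2}{2\theta_1\theta_2}$ and $B=\frac{\theta_3^2}{2\theta_1\theta_2}$, and let $\mu$ and the resonator phase $\phi$ be as in the context. At every pole $\kappa>0$ of $\mu$, i.e. at every zero of $T_N$, the following holds. (i) Generic case: if $\sin(\kappa h)\ne0$, then $$T_N(k)=\frac{[\phi'(\kappa)]^{2N}}{4^{N-1}B^{2N}(\sin\kappa h)^{2(N-1)}}\,(k-\kappa)^{2N}\bigl(1+o(1)\bigr)\quad\text{as }k\to\kappa.$$ (ii) Degenerate case: if $\sin(\kappa h)=0$, then $$T_N(k)=\frac{[\phi'(\kappa)]^{2}}{B^2\,U_{N-1}^2\bigl(A+Bh/\phi'(\kappa)\bigr)}\,(k-\kappa)^{2}\bigl(1+o(1)\bigr)\quad\text{as }k\to\kappa.$$ Thus the vanishing order is $2N$ in case (i), and it is $2$, independently of $N$, in case (ii).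
   Context: Model. The metric graph $G$ has vertices $v_1,\dots,v_N$ of degree 3, placed on the real line (the channel) at $x_j=(j-1)h$, and vertices $u_1,\dots,u_N$ of degree 1. The channel consists of the leads $e_{in}=(-\infty,0]$ (ending at $v_1$), $e_{out}=[(N-1)h,+\infty)$ (starting at $v_N$), and the segments of length $h$ between consecutive $v_j$'s. At each $v_j$ a resonator edge $(v_j,u_j)$ of length $l$ is attached, with coordinate $s\in[0,l]$, $s=0$ at $v_j$ and $s=l$ at $u_j$. At $v=v_j$, $\psi_1(v),\psi_2(v),\psi_3(v)$ denote the limits of $\psi$ at $v$ along the left channel edge, the right channel edge and the resonator edge, and $\psi_i'(v)$ the corresponding one-sided derivatives taken in the direction from $v$ into the edge. Type-I vertex conditions at every $v_j$: $\frac{\psi_1(v)}{\theta_1}=\frac{\psi_2(v)}{\theta_2}=\frac{\psi_3(v)}{\theta_3}$ and $\theta_1\psi_1'(v)+\theta_2\psi_2'(v)+\theta_3\psi_3'(v)=0$. Endpoint condition at each $u_j$: $\alpha\psi+\beta\frac{d\psi}{ds}=0$ at $s=l$. Scattering solution at wavenumber $k>0$: a function $\psi$ on $G$ with $\psi''+k^2\psi=0$ on every edge, satisfying all vertex and endpoint conditions, with $\psi(x)=e^{ikx}+r_N(k)e^{-ikx}$ on $e_{in}$ and $\psi(x)=t_N(k)e^{ikx}$ on $e_{out}$. The amplitudes are uniquely determined; $T_N(k)=|t_N(k)|^2$. Notation. $\mu(k)=\frac{\beta k\tan kl-\alpha}{\beta k+\alpha\tan kl}$, regarded as a meromorphic function,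 i.e. $\mu(k)=\frac{\beta k\sin kl-\alpha\cos kl}{\beta k\cos kl+\alpha\sin kl}$. Resonator phase: $\phi(k)=kl-\delta(k)$, $k>0$, where $\delta\equiv0$ if $\alpha=0$, $\delta\equiv\pi/2$ if $\beta=0$, and $\delta(k)=\arctan\frac{\alpha}{\beta k}$ if $\alpha\beta\ne0$; then $\mu=\tan\phi$. $U_n$ are the Chebyshev polynomials of the second kind: $U_0(\xi)=1$, $U_1(\xi)=2\xi$, $U_{n+2}(\xi)=2\xi U_{n+1}(\xi)-U_n(\xi)$. *)

(* Defs.v *)
From Stdlib Require Import Reals ClassicalEpsilon.
From Coquelicot Require Import Coquelicot.
Open Scope R_scope.

(* e^{ix} for real x *)
Definition expi (x : R) : C := (cos x, sin x).

(* A function on the metric graph.  [channel] is only looked at on the open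
   channel edges (its values at the vertices are irrelevant, since a function
   on the graph may have different limits along different edges); vertices are
   numbered from 0, and [resonator j] is only looked at for j < N, on (0, l),
   with s = 0 at the vertex v and s = l at the free end u. *)
Record graph_fun := GraphFun {
  channel : R -> C;
  resonator : nat -> R -> C
}.

Definition vertex (h : R) (j : nat) : R := INR j * h.

(* f'' + k^2 f = 0 on the open interval (a, b) *)
Definition helmholtz (k : R) (f : R -> C) (a b : Rbar) : Prop :=
  exists f' : R -> C, forall x : R, Rbar_lt a x -> Rbar_lt x b ->
    is_derive f x (f' x) /\ is_derive f' x (RtoC (- k ^ 2) * f x)%C.

(* For an edge parametrized by the distance s > 0 to one of its endpoints:
   p is the limit of g at that endpoint and d the one-sided derivative there,
   in the direction from the endpoint into the edge. *)
Definition edge_trace (g : R -> C) (p d : C) : Prop :=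
  filterlim g (at_right 0) (locally p) /\
  filterlim (fun s : R => ((g s - p) / RtoC s)%C) (at_right 0) (locally d).

Definition edge_equations (N : nat) (h l k : R) (psi : graph_fun) : Prop :=
  helmholtz k (channel psi) m_infty 0 /\
  (forall j : nat, (S j < N)%nat ->
     helmholtz k (channel psi) (vertex h j) (vertex h (S j))) /\
  helmholtz k (channel psi) (vertex h (N - 1)) p_infty /\
  (forall j : nat, (j < N)%nat -> helmholtz k (resonator psi j) 0 l).

Definition typeI_condition (h theta1 theta2 theta3 : R) (psi : graph_fun)
    (j : nat) : Prop :=
  exists p1 p2 p3 d1 d2 d3 : C,
    edge_trace (fun s => channel psi (vertex h j - s)) p1 d1 /\
    edge_trace (fun s => channel psi (vertex h j + s)) p2 d2 /\
    edge_trace (resonator psi j) p3 d3 /\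
    (p1 / RtoC theta1 = p2 / RtoC theta2)%C /\
    (p2 / RtoC theta2 = p3 / RtoC theta3)%C /\
    (RtoC theta1 * d1 + RtoC theta2 * d2 + RtoC theta3 * d3 = 0)%C.

(* alpha psi + beta dpsi/ds = 0 at s = l; here d is the derivative from the
   endpoint into the edge, that is d = - dpsi/ds. *)
Definition endpoint_condition (l alpha beta : R) (psi : graph_fun)
    (j : nat) : Prop :=
  exists p d : C,
    edge_trace (fun s => resonator psi j (l - s)) p d /\
    (RtoC alpha * p + RtoC beta * (- d) = 0)%C.

Definition scattering_solution (N : nat)
    (h l theta1 theta2 theta3 alpha beta k : R)
    (psi : graph_fun) (r t : C) : Prop :=
  edge_equations N h l k psi /\
  (forall j : nat, (j < N)%nat ->
     typeI_condition h theta1 theta2 theta3 psi j /\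
     endpoint_condition l alpha beta psi j) /\
  (forall x : R, x < 0 ->
     channel psi x = (expi (k * x) + r * expi (- (k * x)))%C) /\
  (forall x : R, vertex h (N - 1) < x ->
     channel psi x = (t * expi (k * x))%C).

(* The transmission amplitude is determined by the scattering problem.  It is
   picked by [epsilon], so that nothing can be derived about its value at a
   wavenumber where there is no scattering solution. *)
Definition transmission_amplitude (N : nat)
    (h l theta1 theta2 theta3 alpha beta k : R) : C :=
  epsilon (inhabits (RtoC 0)) (fun t : C =>
    exists (psi : graph_fun) (r : C),
      scattering_solution N h l theta1 theta2 theta3 alpha beta k psi r t).

Definition transmission_probability (N : nat)
    (h l theta1 theta2 theta3 alpha beta k : R) : R :=
  Cmod (transmission_amplitude N h l theta1 theta2 theta3 alpha beta k) ^ 2.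

Definition mu (l alpha beta k : R) : R :=
  (beta * k * sin (k * l) - alpha * cos (k * l)) /
  (beta * k * cos (k * l) + alpha * sin (k * l)).

(* A real pole of a function meromorphic near the real axis, read off from its
   restriction to the real axis: |f(k)| -> +oo as k -> kappa. *)
Definition is_pole (f : R -> R) (kappa : R) : Prop :=
  is_lim (fun k => Rabs (f k)) kappa p_infty.

Definition phase_shift (alpha beta k : R) : R :=
  if Req_EM_T alpha 0 then 0
  else if Req_EM_T beta 0 then PI / 2
  else atan (alpha / (beta * k)).

Definition resonator_phase (l alpha beta k : R) : R :=
  k * l - phase_shift alpha beta k.

Fixpoint chebyshevU (n : nat) (xi : R) : R :=
  match n with
  | O => 1
  | S O => 2 * xi
  | S (S m as n') => 2 * xi * chebyshevU n' xi - chebyshevU m xi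
  end.

(* f(k) = g(k) (1 + o(1)) as k -> kappa *)
Definition asymptotic_at (kappa : R) (f g : R -> R) : Prop :=
  exists eps : R -> R,
    is_lim eps kappa 0 /\ locally' kappa (fun k => f k = g k * (1 + eps k)).

Definition vanishing_order (f : R -> R) (kappa : R) (m : nat) : Prop :=
  exists c : R, c <> 0 /\ is_lim (fun k => f k / (k - kappa) ^ m) kappa c.

(* Main.v *)
Require Import Defs.
From Stdlib Require Import Reals ClassicalEpsilon Lra Lia.
From Coquelicot Require Import Coquelicot.
Open Scope R_scope.

(** On every edge a solution is a combination of [cos] and [sin], so a scattering
    solution is a finite list of amplitudes.  Resonators are eliminated one by
    one: where [mu] is finite, the endpoint condition forces the derivative of
    the resonator wave at its vertex to be [k mu] times its value, and the vertex
    becomes a unimodular transfer matrix between the channel data on its two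
    sides.  Propagating the outgoing wave from the last vertex back to the first
    is then the iteration of one unimodular matrix, whose trace is twice
    [xi = A cos kh - B mu sin kh]; its powers are Chebyshev polynomials of [xi]
    ([cross_back_data]).  Reading off the incoming wave gives the amplitude, and
    the quadratic invariant of the Chebyshev recurrence turns its modulus into

      [T = 1 / (1 + (A^2 - 1 + B^2 mu^2) U_{N-1}(xi)^2)]

    ([transmission_formula]).  This never vanishes.  Where the denominator of
    [mu] is zero, the resonators force the wave to vanish at all vertices, so
    [T = 0] ([transmission_zero]); these points are exactly the poles of [mu].

    At a pole [kappa] one has [(k - kappa) mu -> - 1 / phi'(kappa)]
    ([mu_residue]), where [phi'(kappa) > 0].  If [sin kappa h <> 0], then [xi] has
    a simple pole, [(k - kappa)^n U_n(xi)] tends to [(2 B sin(kappa h) / phi')^n],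
    and each resonator contributes one factor [(k - kappa)^2] to [T].  If
    [sin kappa h = 0], the zero of the sine cancels the pole of [mu], and [xi]
    stays bounded with limit [cos(kappa h) (A + B h / phi')].  As
    [A + B h / phi' >= 1], the polynomial [U_{N-1}] does not vanish there, and the
    only divergence left is that of the factor [B^2 mu^2]. *)

(** * Waves on an edge *)

(** [D] holds the value at [s = 0] and the derivative there divided by [k]. *)
Definition wave (k : R) (D : C * C) (s : R) : C :=
  (fst D * cos (k * s) + snd D * sin (k * s))%C.

Definition wave_deriv (k : R) (D : C * C) (s : R) : C :=
  (RtoC k * (snd D * cos (k * s) - fst D * sin (k * s)))%C.

Lemma RtoC_neq_0 (x : R) : x <> 0 -> RtoC x <> 0%C.
Proof. intros Hx E; apply Hx, RtoC_inj, E. Qed.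

Lemma RtoC_sin_square (x : R) :
  (RtoC (sin x) * sin x = 1 - RtoC (cos x) * cos x)%C.
Proof.
  rewrite <- !RtoC_mult, <- RtoC_minus. f_equal.
  generalize (sin2_cos2 x). unfold Rsqr. lra.
Qed.

Lemma is_derive_wave (k : R) (D : C * C) (s : R) :
  is_derive (wave k D) s (wave_deriv k D s).
Proof.
  destruct D as [P Q].
  apply is_derive_ext with
    (f := fun s => plus (scal (cos (k * s)) P) (scal (sin (k * s)) Q)).
  { intros t. unfold wave; simpl fst; simpl snd.
    rewrite !scal_R_Cmult. unfold plus; simpl.
    change (RtoC (cos (k * t)) * P + RtoC (sin (k * t)) * Q =
            P * RtoC (cos (k * t)) + Q * RtoC (sin (k * t)))%C. ring. }
  replace (wave_deriv k (P, Q) s)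
    with (plus (scal (- k * sin (k * s)) P) (scal (k * cos (k * s)) Q)).
  { apply (is_derive_plus (V := C_R_NormedModule));
      apply (is_derive_scal_l (V := C_R_NormedModule)); auto_derive; auto; ring. }
  rewrite !scal_R_Cmult. unfold wave_deriv; simpl fst; simpl snd.
  rewrite !RtoC_mult, RtoC_opp.
  change (- RtoC k * RtoC (sin (k * s)) * P + RtoC k * RtoC (cos (k * s)) * Q =
    RtoC k * (Q * RtoC (cos (k * s)) - P * RtoC (sin (k * s))))%C. ring.
Qed.

Lemma is_derive_shift (f : R -> C) (y x : R) (d : C) :
  is_derive f (x - y) d -> is_derive (fun t => f (t - y)) x d.
Proof.
  intros H.
  replace d with (scal 1 d)
    by (rewrite scal_R_Cmult; apply Cmult_1_l).
  apply (is_derive_comp (V := C_R_NormedModule) f (fun t => t - y)); auto.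
  auto_derive; auto.
Qed.

Lemma wave_deriv_wave (k : R) (D : C * C) (s : R) :
  wave_deriv k D s = wave k (k * snd D, - (k * fst D))%C s.
Proof. unfold wave_deriv, wave; simpl; ring. Qed.

Lemma helmholtz_wave (k y : R) (D : C * C) (f : R -> C) (a b : Rbar) :
  (forall x : R, Rbar_lt a x -> Rbar_lt x b -> f x = wave k D (x - y)) ->
  helmholtz k f a b.
Proof.
  intros Hf.
  exists (fun x => wave_deriv k D (x - y)). intros x Hax Hxb. split.
  - apply is_derive_ext_loc with (f := fun t => wave k D (t - y)).
    + assert (La : locally x (fun t : R => Rbar_lt a t))
        by exact (open_Rbar_gt' x a Hax).
      assert (Lb : locally x (fun t : R => Rbar_lt t b))
        by exact (open_Rbar_lt' x b Hxb).
      generalize (filter_and _ _ La Lb). apply filter_imp.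
      intros t [Ha Hb]. symmetry; auto.
    + apply is_derive_shift, is_derive_wave.
  - replace (RtoC (- k ^ 2) * f x)%C
      with (wave_deriv k (k * snd D, - (k * fst D))%C (x - y)).
    + apply is_derive_ext with
        (f := fun t => wave k (k * snd D, - (k * fst D))%C (t - y)).
      { intros t. symmetry; apply wave_deriv_wave. }
      apply is_derive_shift, is_derive_wave.
    + rewrite (Hf x Hax Hxb). unfold wave_deriv, wave; simpl fst; simpl snd.
      rewrite RtoC_opp, RtoC_pow. ring.
Qed.

Lemma is_derive_scal_fct (u : R -> R) (f : R -> C) (x u' : R) (f' : C) :
  is_derive u x u' -> is_derive f x f' ->
  is_derive (fun t => RtoC (u t) * f t)%C x (RtoC u' * f x + RtoC (u x) * f')%C.
Proof.
  intros Hu Hf.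
  apply is_derive_ext with (f := fun t => scal (u t) (f t)).
  { intros t; apply scal_R_Cmult. }
  unfold is_derive.
  eapply filterdiff_ext_lin.
  - apply (filterdiff_scal_fct (V := C_R_NormedModule) x u f); [ | exact Hu | exact Hf ].
    intros; apply Rmult_comm.
  - intros t; simpl.
    rewrite !(scal_R_Cmult _ _). unfold scal, plus; simpl.
    unfold mult; simpl.
    change (RtoC (t * u') * f x + RtoC (u x) * (RtoC t * f') =
      RtoC t * (RtoC u' * f x + RtoC (u x) * f'))%C.
    rewrite RtoC_mult. ring.
Qed.

(** The endpoints may be infinite, as on the leads. *)
Lemma constant_on_interval (g : R -> C) (a b : Rbar) (x x0 : R) :
  (forall t : R, Rbar_lt a t -> Rbar_lt t b -> is_derive g t (RtoC 0)) ->
  Rbar_lt a x -> Rbar_lt x b -> Rbar_lt a x0 -> Rbar_lt x0 b -> g x = g x0.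
Proof.
  intros H Hx1 Hx2 Hy1 Hy2.
  assert (K : forall u v : R, Rbar_lt a u -> Rbar_lt v b -> u < v -> g u = g v).
  { intros u v Hu Hv Huv.
    apply (eq_is_derive (V := C_R_NormedModule)); auto.
    intros t [H1 H2]. apply H.
    - apply Rbar_lt_le_trans with u; auto.
    - apply Rbar_le_lt_trans with v; auto. }
  destruct (Rtotal_order x x0) as [Hlt | [-> | Hgt]]; auto.
  symmetry; auto.
Qed.

(** Variation of constants: rotating the vector of [f] and [f' / k] back by the
    angle [k (x - y)] gives a vector with zero derivative, whose entries are the
    amplitudes of the wave. *)
Lemma helmholtz_is_wave (k y x0 : R) (f : R -> C) (a b : Rbar) :
  k <> 0 -> Rbar_lt a x0 -> Rbar_lt x0 b -> helmholtz k f a b ->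
  exists D : C * C,
    forall x : R, Rbar_lt a x -> Rbar_lt x b -> f x = wave k D (x - y).
Proof.
  intros Hk Ha0 Hb0 [f' Hf].
  set (P := fun x : R => (RtoC (cos (k * (x - y))) * f x
                          + RtoC (- sin (k * (x - y)) / k) * f' x)%C).
  set (Q := fun x : R => (RtoC (sin (k * (x - y))) * f x
                          + RtoC (cos (k * (x - y)) / k) * f' x)%C).
  assert (Hk' := RtoC_neq_0 k Hk).
  assert (HP : forall t : R, Rbar_lt a t -> Rbar_lt t b ->
             is_derive P t (RtoC 0)).
  { intros t H1 H2. destruct (Hf t H1 H2) as [D1 D2].
    replace (RtoC 0) with
      (plus (RtoC (- k * sin (k * (t - y))) * f t + RtoC (cos (k * (t - y))) * f' t)%C
            (RtoC (- cos (k * (t - y))) * f' t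
             + RtoC (- sin (k * (t - y)) / k) * (RtoC (- k ^ 2) * f t))%C).
    - apply (is_derive_plus (V := C_R_NormedModule)).
      + apply (is_derive_scal_fct (fun t => cos (k * (t - y)))); auto.
        auto_derive; auto; unfold Rminus; ring.
      + apply (is_derive_scal_fct (fun t => - sin (k * (t - y)) / k)); auto.
        auto_derive; auto; unfold Rminus; field; auto.
    - change (RtoC (- k * sin (k * (t - y))) * f t + RtoC (cos (k * (t - y))) * f' t
        + (RtoC (- cos (k * (t - y))) * f' t
             + RtoC (- sin (k * (t - y)) / k) * (RtoC (- k ^ 2) * f t)) = 0)%C.
      rewrite RtoC_div, !RtoC_mult, !RtoC_opp, RtoC_pow by auto. field; auto. }
  assert (HQ : forall t : R, Rbar_lt a t -> Rbar_lt t b ->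
             is_derive Q t (RtoC 0)).
  { intros t H1 H2. destruct (Hf t H1 H2) as [D1 D2].
    replace (RtoC 0) with
      (plus (RtoC (k * cos (k * (t - y))) * f t + RtoC (sin (k * (t - y))) * f' t)%C
            (RtoC (- sin (k * (t - y))) * f' t
             + RtoC (cos (k * (t - y)) / k) * (RtoC (- k ^ 2) * f t))%C).
    - apply (is_derive_plus (V := C_R_NormedModule)).
      + apply (is_derive_scal_fct (fun t => sin (k * (t - y)))); auto.
        auto_derive; auto; unfold Rminus; ring.
      + apply (is_derive_scal_fct (fun t => cos (k * (t - y)) / k)); auto.
        auto_derive; auto; unfold Rminus; field; auto.
    - change (RtoC (k * cos (k * (t - y))) * f t + RtoC (sin (k * (t - y))) * f' t
        + (RtoC (- sin (k * (t - y))) * f' t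
             + RtoC (cos (k * (t - y)) / k) * (RtoC (- k ^ 2) * f t)) = 0)%C.
      rewrite RtoC_div, !RtoC_mult, !RtoC_opp, RtoC_pow by auto. field; auto. }
  exists (P x0, Q x0). intros x H1 H2.
  rewrite <- (constant_on_interval P a b x x0 HP), <- (constant_on_interval Q a b x x0 HQ)
    by auto.
  unfold wave, P, Q; simpl fst; simpl snd.
  rewrite !RtoC_div, RtoC_opp by auto.
  transitivity ((RtoC (cos (k * (x - y))) * RtoC (cos (k * (x - y)))
     + RtoC (sin (k * (x - y))) * RtoC (sin (k * (x - y)))) * f x)%C.
  - rewrite RtoC_sin_square. ring.
  - field; auto.
Qed.

(** Together with [edge_trace_unique], this turns every statement about one-sided
    limits of a wave into a statement about its two amplitudes. *)
Lemma edge_trace_wave (k a : R) (D : C * C) (g : R -> C) :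
  0 < a -> (forall s, 0 < s < a -> g s = wave k D s) ->
  edge_trace g (fst D) (k * snd D)%C.
Proof.
  intros Ha Hg.
  assert (near : at_right 0 (fun s => g s = wave k D s /\ 0 < s)).
  { exists (mkposreal a Ha). intros s Hs H0. split; auto. apply Hg. split; auto.
    unfold ball in Hs; simpl in Hs; unfold AbsRing_ball, abs, minus, plus, opp in Hs;
    simpl in Hs. apply Rabs_def2 in Hs. lra. }
  assert (W0 : wave k D 0 = fst D).
  { unfold wave. rewrite Rmult_0_r, cos_0, sin_0. ring. }
  assert (dW : is_derive (wave k D) 0 (k * snd D)%C).
  { replace (k * snd D)%C with (wave_deriv k D 0); [ apply is_derive_wave | ].
    unfold wave_deriv. rewrite Rmult_0_r, cos_0, sin_0. ring. }
  split.
  - apply (filterlim_ext_loc (wave k D)).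
    { generalize near. apply filter_imp. intros s [H _]; auto. }
    rewrite <- W0.
    apply (filterlim_filter_le_1 (F := locally 0)).
    + apply filter_le_within.
    + apply (ex_derive_continuous (V := C_R_NormedModule) (wave k D) 0).
      eexists; exact dW.
  (* The difference quotient converges by the definition of the derivative:
     the remainder is [s Z], and [Z] is the error to be bounded. *)
  - destruct dW as [_ dW].
    specialize (dW 0 (fun P H => H)).
    apply (filterlim_locally (F := at_right 0) (U := C_R_NormedModule)).
    intros eps.
    assert (eps2 : 0 < eps / 2) by (generalize (cond_pos eps); lra).
    specialize (dW (mkposreal _ eps2)).
    assert (dW' := filter_le_within (F := locally 0) (fun u => 0 < u) _ dW).
    generalize (filter_and _ _ near dW'). apply filter_imp.
    intros s [[E Hs] B]. 
    apply (norm_compat1 (V := C_R_NormedModule)).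
    simpl in B.
    rewrite E.
    match goal with |- norm ?z < _ => set (Z := z) end.
    assert (HZ : (minus (minus (wave k D s) (wave k D 0)) (scal (minus s 0) (k * snd D)%C)) = scal s Z).
    { rewrite !scal_R_Cmult. unfold Z. rewrite W0.
      change (minus s 0) with (s + - 0). rewrite Ropp_0, Rplus_0_r.
      change (wave k D s - fst D - RtoC s * (k * snd D) =
       RtoC s * ((wave k D s - fst D) / RtoC s - k * snd D))%C.
      field. intros E'. apply RtoC_inj in E'. lra. }
    assert (B' : norm (V := C_R_NormedModule) (scal s Z) <= eps / 2 * Rabs s).
    { rewrite <- HZ. replace (Rabs s) with (Rabs (s + - 0)) by (f_equal; ring).
      exact B. }
    assert (norm (V := C_R_NormedModule) Z <= eps / 2).
    { replace Z with (scal (/ s) (scal s Z)).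
      - eapply Rle_trans; [ apply (norm_scal (V := C_R_NormedModule)) | ].
        change (abs (/ s)) with (Rabs (/ s)).
        rewrite Rabs_pos_eq in B' by lra.
        rewrite Rabs_pos_eq by (apply Rlt_le, Rinv_0_lt_compat; lra).
        apply Rmult_le_reg_l with s; [ lra | ].
        rewrite <- Rmult_assoc, Rinv_r, Rmult_1_l by lra. lra.
      - rewrite !scal_R_Cmult, RtoC_inv by lra.
        change (/ RtoC s * (RtoC s * Z) = Z :> C)%C.
        field. intros E'. apply RtoC_inj in E'. lra. }
    apply Rle_lt_trans with (eps / 2); auto.
    generalize (cond_pos eps). lra.
Qed.

Lemma edge_trace_unique (g : R -> C) (p d p' d' : C) :
  edge_trace g p d -> edge_trace g p' d' -> p = p' /\ d = d'.
Proof.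
  intros [H1 H2] [H1' H2'].
  assert (F : ProperFilter' (at_right 0))
    by (apply Proper_StrongProper; apply at_right_proper_filter).
  assert (E : p = p')
    by exact (filterlim_locally_unique (V := C_R_NormedModule) (F := at_right 0) g p p' H1 H1').
  split; auto. subst p'.
  exact (filterlim_locally_unique (V := C_R_NormedModule) (F := at_right 0) _ d d' H2 H2').
Qed.

(** * The scattering problem for the edge amplitudes *)

(** The amplitudes of the same wave, seen from the other end of an edge of
    length [h] ([wave_far_end]). *)
Definition far_end (k h : R) (D : C * C) : C * C :=
  (fst D * cos (k * h) + snd D * sin (k * h),
   fst D * sin (k * h) - snd D * cos (k * h))%C.

Definition mu_num (l alpha beta k : R) : R :=
  beta * k * sin (k * l) - alpha * cos (k * l).

Definition mu_den (l alpha beta k : R) : R :=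
  beta * k * cos (k * l) + alpha * sin (k * l).

Definition vertex_rel (theta1 theta2 theta3 : R) (L D W : C * C) : Prop :=
  (fst L / theta1 = fst D / theta2)%C /\
  (fst D / theta2 = fst W / theta3)%C /\
  (theta1 * snd L + theta2 * snd D + theta3 * snd W = 0)%C.

Definition endpoint_rel (l alpha beta k : R) (W : C * C) : Prop :=
  (mu_den l alpha beta k * snd W = mu_num l alpha beta k * fst W)%C.

(** [L j], [D j] and [W j] are the amplitudes on the left channel edge, the right
    channel edge and the resonator at the vertex [j], all with the derivative
    taken from the vertex into the edge.  The values at [0] and at [N - 1] are
    those of the waves prescribed on the two leads. *)
Definition discrete_solution (N : nat)
    (h l theta1 theta2 theta3 alpha beta k : R)
    (L D W : nat -> C * C) (r t : C) : Prop :=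
  L 0%nat = (1 + r, Ci * (r - 1))%C /\
  (forall j, (S j < N)%nat -> L (S j) = far_end k h (D j)) /\
  D (N - 1)%nat = (t * expi (k * vertex h (N - 1)),
                   Ci * (t * expi (k * vertex h (N - 1))))%C /\
  (forall j, (j < N)%nat ->
     vertex_rel theta1 theta2 theta3 (L j) (D j) (W j) /\
     endpoint_rel l alpha beta k (W j)).

Lemma wave_far_end (k h : R) (D : C * C) (s : R) :
  wave k D (h - s) = wave k (far_end k h D) s.
Proof.
  unfold wave, far_end; simpl fst; simpl snd.
  replace (k * (h - s)) with (k * h - k * s) by ring.
  rewrite cos_minus, sin_minus, RtoC_plus, RtoC_minus, !RtoC_mult. ring.
Qed.

Lemma far_end_involutive (k h : R) (D : C * C) : far_end k h (far_end k h D) = D.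
Proof.
  destruct D as [P Q]. unfold far_end; simpl fst; simpl snd.
  f_equal; ring [(RtoC_sin_square (k * h))].
Qed.

Lemma expi_wave (k x : R) (c : C) :
  (c * expi (k * x))%C = wave k (c, Ci * c)%C x.
Proof.
  unfold wave, expi; simpl fst; simpl snd.
  apply injective_projections; simpl; ring.
Qed.

Lemma expi_add (x y : R) : expi (x + y) = (expi x * expi y)%C.
Proof.
  unfold expi. rewrite cos_plus, sin_plus.
  apply injective_projections; simpl; ring.
Qed.

Lemma Cmod_expi (x : R) : Cmod (expi x) = 1.
Proof.
  unfold Cmod, expi; simpl fst; simpl snd. rewrite <- sqrt_1. f_equal.
  generalize (sin2_cos2 x); unfold Rsqr; nra.
Qed.

Lemma lead_wave (k x : R) (r : C) :
  (expi (k * x) + r * expi (- (k * x)))%C = wave k (1 + r, Ci * (1 - r))%C x.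
Proof.
  unfold wave, expi; simpl fst; simpl snd.
  rewrite cos_neg, sin_neg.
  apply injective_projections; simpl; ring.
Qed.

Lemma wave_opp (k s : R) (P Q : C) : wave k (P, Q) (- s) = wave k (P, - Q)%C s.
Proof.
  unfold wave; simpl fst; simpl snd.
  replace (k * - s) with (- (k * s)) by ring.
  rewrite cos_neg, sin_neg, RtoC_opp. ring.
Qed.

(** The three waves need only be known near the vertex, here up to a common
    distance [a]. *)
Lemma typeI_condition_wave (h theta1 theta2 theta3 k a : R) (psi : graph_fun)
    (j : nat) (L D W : C * C) :
  k <> 0 -> 0 < a ->
  (forall s, 0 < s < a -> channel psi (vertex h j - s) = wave k L s) ->
  (forall s, 0 < s < a -> channel psi (vertex h j + s) = wave k D s) ->
  (forall s, 0 < s < a -> resonator psi j s = wave k W s) ->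
  typeI_condition h theta1 theta2 theta3 psi j <->
  vertex_rel theta1 theta2 theta3 L D W.
Proof.
  intros Hk Ha HL HD HW. apply RtoC_neq_0 in Hk.
  apply (edge_trace_wave k a L (fun s => channel psi (vertex h j - s)) Ha) in HL.
  apply (edge_trace_wave k a D (fun s => channel psi (vertex h j + s)) Ha) in HD.
  apply (edge_trace_wave k a W _ Ha) in HW.
  split.
  - intros (p1 & p2 & p3 & d1 & d2 & d3 & T1 & T2 & T3 & E1 & E2 & E3).
    destruct (edge_trace_unique _ _ _ _ _ T1 HL) as [-> ->].
    destruct (edge_trace_unique _ _ _ _ _ T2 HD) as [-> ->].
    destruct (edge_trace_unique _ _ _ _ _ T3 HW) as [-> ->].
    split; [ | split ]; auto.
    transitivity ((theta1 * (k * snd L) + theta2 * (k * snd D)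
                   + theta3 * (k * snd W)) / k)%C.
    + field; auto.
    + rewrite E3. field; auto.
  - intros (E1 & E2 & E3).
    exists (fst L), (fst D), (fst W), (k * snd L)%C, (k * snd D)%C, (k * snd W)%C.
    repeat split; auto; try apply HL; try apply HD; try apply HW.
    transitivity (k * (theta1 * snd L + theta2 * snd D + theta3 * snd W))%C.
    + ring.
    + rewrite E3. ring.
Qed.

Lemma endpoint_condition_wave (l alpha beta k : R) (psi : graph_fun)
    (j : nat) (W : C * C) :
  0 < l -> (forall s, 0 < s < l -> resonator psi j s = wave k W s) ->
  endpoint_condition l alpha beta psi j <-> endpoint_rel l alpha beta k W.
Proof.
  intros Hl HW.
  assert (H : edge_trace (fun s => resonator psi j (l - s))
                (fst (far_end k l W)) (k * snd (far_end k l W))%C).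
  { apply edge_trace_wave with l; auto.
    intros s Hs. rewrite HW by lra. apply wave_far_end. }
  assert (E : (alpha * fst (far_end k l W) + beta * (- (k * snd (far_end k l W)))
    = mu_den l alpha beta k * snd W - mu_num l alpha beta k * fst W)%C).
  { unfold far_end, mu_den, mu_num; simpl fst; simpl snd.
    rewrite RtoC_plus, RtoC_minus, !RtoC_mult. ring. }
  unfold endpoint_rel. rewrite Ceq_minus, <- E. split.
  - intros (p & d & T & Hpd).
    destruct (edge_trace_unique _ _ _ _ _ T H) as [-> ->]; auto.
  - intros Hpd. eexists; eexists; split; [ exact H | exact Hpd ].
Qed.

Lemma vertex_S (h : R) (j : nat) : vertex h (S j) = vertex h j + h.
Proof. unfold vertex. rewrite S_INR. ring. Qed.

Lemma vertex_le (h : R) (i j : nat) : 0 < h -> (i <= j)%nat -> vertex h i <= vertex h j.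
Proof.
  intros Hh Hij. apply Rmult_le_compat_r; [ lra | apply le_INR; auto ].
Qed.

Lemma vertex_0 (h : R) : vertex h 0 = 0.
Proof. unfold vertex; simpl; ring. Qed.

(** A function on the channel glued from [lead] on the incoming lead and
    [piece j] to the right of the vertex [j]. *)
Fixpoint piecewise (h : R) (lead : R -> C) (piece : nat -> R -> C) (n : nat)
    (x : R) : C :=
  match n with
  | O => lead x
  | S m => if Rlt_dec x (vertex h m) then piecewise h lead piece m x
           else piece m x
  end.

Lemma piecewise_lead (h : R) (lead : R -> C) (piece : nat -> R -> C) (n : nat) (x : R) :
  0 < h -> x < 0 -> piecewise h lead piece n x = lead x.
Proof.
  intros Hh Hx. induction n as [ | n IH ]; simpl; auto.
  assert (V := vertex_le h 0 n Hh (Nat.le_0_l n)). rewrite vertex_0 in V.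
  destruct (Rlt_dec x (vertex h n)); auto; lra.
Qed.

Lemma piecewise_piece (h : R) (lead : R -> C) (piece : nat -> R -> C)
    (n j : nat) (x : R) :
  0 < h -> (j < n)%nat -> vertex h j <= x ->
  ((S j < n)%nat -> x < vertex h (S j)) ->
  piecewise h lead piece n x = piece j x.
Proof.
  intros Hh Hj Hx Hx'. induction n as [ | n IH ]; [ lia | ]. simpl.
  destruct (Nat.eq_dec j n) as [ -> | Hjn ].
  - destruct (Rlt_dec x (vertex h n)); auto; lra.
  - assert (x < vertex h (S j)) by (apply Hx'; lia).
    assert (V := vertex_le h (S j) n Hh ltac:(lia)).
    destruct (Rlt_dec x (vertex h n)); [ apply IH; auto; lia | lra ].
Qed.

(** With [scattering_discrete], this makes the scattering problem on the graph
    equivalent to the algebraic one. *)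
Lemma discrete_scattering (N : nat) (h l theta1 theta2 theta3 alpha beta k : R)
    (L D W : nat -> C * C) (r t : C) :
  (1 <= N)%nat -> 0 < h -> 0 < l -> 0 < k ->
  discrete_solution N h l theta1 theta2 theta3 alpha beta k L D W r t ->
  exists psi : graph_fun,
    scattering_solution N h l theta1 theta2 theta3 alpha beta k psi r t.
Proof.
  intros HN Hh Hl Hk (HL0 & HLS & HDlast & Hrel).
  set (lead := fun x : R => (expi (k * x) + r * expi (- (k * x)))%C).
  set (piece := fun (j : nat) (x : R) => wave k (D j) (x - vertex h j)).
  set (psi := GraphFun (piecewise h lead piece N) (fun j => wave k (W j))).
  assert (Hlead : forall x, x < 0 -> channel psi x = lead x)
    by (intros; apply piecewise_lead; auto).
  assert (Hpiece : forall j x, (j < N)%nat -> vertex h j <= x ->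
            ((S j < N)%nat -> x < vertex h (S j)) -> channel psi x = piece j x)
    by (intros; apply piecewise_piece; auto).
  exists psi. split; [ | split; [ | split ]].
  - split; [ | split; [ | split ]].
    + apply helmholtz_wave with 0 (1 + r, Ci * (1 - r))%C.
      intros x _ Hx. rewrite Hlead by auto. rewrite Rminus_0_r. apply lead_wave.
    + intros j Hj. apply helmholtz_wave with (vertex h j) (D j).
      intros x Hx1 Hx2. simpl in Hx1, Hx2.
      apply Hpiece; auto with real; lia.
    + apply helmholtz_wave with (vertex h (N - 1)) (D (N - 1)%nat).
      intros x Hx _. simpl in Hx. apply Hpiece; try lia. lra.
    + intros j _. apply helmholtz_wave with 0 (W j).
      intros x _ _. rewrite Rminus_0_r. reflexivity.
  - intros j Hj. destruct (Hrel j Hj) as [Hv He]. split.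
    + apply (typeI_condition_wave h theta1 theta2 theta3 k h psi j (L j) (D j) (W j));
        auto; try lra; intros s Hs.
      * destruct j as [ | j ].
        -- rewrite vertex_0, Hlead by lra. unfold lead.
           rewrite lead_wave. replace (0 - s) with (- s) by ring.
           rewrite wave_opp, HL0. f_equal. f_equal. ring.
        -- rewrite HLS, <- wave_far_end by auto.
           rewrite vertex_S, (Hpiece j) by (try lia; try rewrite vertex_S; lra).
           unfold piece. f_equal. ring.
      * rewrite (Hpiece j); auto; try lra.
        -- unfold piece. f_equal. ring.
        -- rewrite vertex_S. lra.
    + apply (endpoint_condition_wave l alpha beta k psi j (W j)); auto.
  - exact Hlead.
  - intros x Hx. rewrite (Hpiece (N - 1)%nat) by (try lia; lra).
    unfold piece. rewrite HDlast, <- expi_wave, <- Cmult_assoc, <- expi_add.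
    do 2 f_equal. ring.
Qed.

Lemma scattering_discrete (N : nat) (h l theta1 theta2 theta3 alpha beta k : R)
    (psi : graph_fun) (r t : C) :
  (1 <= N)%nat -> 0 < h -> 0 < l -> 0 < k ->
  scattering_solution N h l theta1 theta2 theta3 alpha beta k psi r t ->
  exists L D W : nat -> C * C,
    discrete_solution N h l theta1 theta2 theta3 alpha beta k L D W r t.
Proof.
  intros HN Hh Hl Hk ((_ & Hseg & _ & Hres) & Hcond & Hin & Hout).
  set (tau := (t * expi (k * vertex h (N - 1)))%C).
  (* On the last edge the amplitudes are prescribed, not chosen. *)
  assert (HD : forall j, exists D : C * C, (j = N - 1 -> D = (tau, Ci * tau)%C)%nat /\
    ((j < N)%nat -> forall s, 0 < s < h -> channel psi (vertex h j + s) = wave k D s)).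
  { intros j. destruct (Nat.lt_ge_cases (S j) N) as [Hj | Hj].
    - destruct (helmholtz_is_wave k (vertex h j) (vertex h j + h / 2)
                  (channel psi) (vertex h j) (vertex h (S j))) as [D HD];
        try (simpl; rewrite ?vertex_S; lra); auto.
      exists D; split; [ lia | ]. intros _ s Hs.
      rewrite HD by (simpl; rewrite ?vertex_S; lra). f_equal. ring.
    - exists (tau, Ci * tau)%C; split; auto. intros Hj' s Hs.
      replace j with (N - 1)%nat by lia.
      rewrite Hout, <- expi_wave by lra. unfold tau.
      rewrite <- Cmult_assoc, <- expi_add. do 2 f_equal. ring. }
  assert (HW : forall j, exists W : C * C,
    (j < N)%nat -> forall s, 0 < s < l -> resonator psi j s = wave k W s).
  { intros j. destruct (Nat.lt_ge_cases j N) as [Hj | Hj].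
    - destruct (helmholtz_is_wave k 0 (l / 2) (resonator psi j) 0 l) as [W HW];
        try (simpl; lra); auto.
      exists W. intros _ s Hs. rewrite HW by (simpl; lra). f_equal. ring.
    - exists (RtoC 0, RtoC 0). lia. }
  set (D := fun j => proj1_sig (constructive_indefinite_description _ (HD j))).
  set (W := fun j => proj1_sig (constructive_indefinite_description _ (HW j))).
  assert (HD' : forall j, (j = N - 1 -> D j = (tau, Ci * tau)%C)%nat /\
    ((j < N)%nat -> forall s, 0 < s < h -> channel psi (vertex h j + s) = wave k (D j) s))
    by (intros j; exact (proj2_sig (constructive_indefinite_description _ (HD j)))).
  assert (HW' : forall j,
    (j < N)%nat -> forall s, 0 < s < l -> resonator psi j s = wave k (W j) s)
    by (intros j; exact (proj2_sig (constructive_indefinite_description _ (HW j)))).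
  exists (fun j => match j with
                   | O => (1 + r, Ci * (r - 1))%C
                   | S i => far_end k h (D i)
                   end), D, W.
  split; [ | split; [ | split ]]; auto.
  - apply HD'; auto.
  - intros j Hj. destruct (Hcond j Hj) as [Hv He].
    assert (Hml : Rmin h l <= h /\ Rmin h l <= l) by (split; [ apply Rmin_l | apply Rmin_r ]).
    split.
    + refine (proj1 (typeI_condition_wave h theta1 theta2 theta3 k (Rmin h l) psi j _ _ _
                       _ _ _ _ _) Hv).
      * lra.
      * apply Rmin_glb_lt; auto.
      * intros s Hs. destruct j as [ | j ].
        -- rewrite vertex_0, Hin by lra. rewrite lead_wave.
           replace (0 - s) with (- s) by ring.
           rewrite wave_opp. f_equal. f_equal. ring.
        -- rewrite <- wave_far_end, <- (proj2 (HD' j)) by (try lia; lra).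
           f_equal. rewrite vertex_S. ring.
      * intros s Hs. apply HD'; auto; lra.
      * intros s Hs. apply HW'; auto; lra.
    + apply (endpoint_condition_wave l alpha beta k psi j (W j)); auto.
Qed.

(** * Elimination of the resonators *)

(** Numerator and denominator of [mu] arise from [(beta k, alpha)] by a rotation;
    hence they never vanish together. *)
Lemma mu_num_den (l alpha beta k : R) :
  mu_num l alpha beta k ^ 2 + mu_den l alpha beta k ^ 2
  = (beta * k) ^ 2 + alpha ^ 2.
Proof.
  unfold mu_num, mu_den.
  replace ((beta * k) ^ 2 + alpha ^ 2)
    with (((beta * k) ^ 2 + alpha ^ 2) * ((sin (k * l))² + (cos (k * l))²))
    by (rewrite sin2_cos2; ring).
  unfold Rsqr; ring.
Qed.

Lemma mu_num_neq_0 (l alpha beta k : R) :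
  (alpha, beta) <> (0, 0) -> 0 < k -> mu_den l alpha beta k = 0 ->
  mu_num l alpha beta k <> 0.
Proof.
  intros Hab Hk Hden Hnum.
  assert (E := mu_num_den l alpha beta k). rewrite Hden, Hnum in E.
  apply Hab.
  assert (beta * k = 0) by nra. assert (alpha = 0) by nra.
  f_equal; auto. apply Rmult_integral in H as [H | H]; lra.
Qed.

(** [U_{n-1}], with [U_{-1} = 0], so that the recurrence holds from [n = 0] on. *)
Definition chebyshevU_pred (n : nat) (xi : R) : R :=
  match n with O => 0 | S m => chebyshevU m xi end.

Lemma chebyshevU_S (n : nat) (xi : R) :
  chebyshevU (S n) xi = 2 * xi * chebyshevU n xi - chebyshevU_pred n xi.
Proof. destruct n; simpl; ring. Qed.

(** The determinant of the [n]-th power of a unimodular matrix, in Chebyshev form. *)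
Lemma chebyshevU_invariant (n : nat) (xi : R) :
  chebyshevU n xi ^ 2 - 2 * xi * chebyshevU n xi * chebyshevU_pred n xi
  + chebyshevU_pred n xi ^ 2 = 1.
Proof.
  induction n as [ | n IH ].
  - simpl; ring.
  - simpl chebyshevU_pred. rewrite chebyshevU_S. rewrite <- IH. ring.
Qed.

(** The channel amplitudes to the left of a vertex, in terms of those to the
    right, when the derivative of the resonator wave at the vertex is [k m] times
    its value; the resonators of the theorem have [m = mu]. *)
Definition cross (theta1 theta2 theta3 m : R) (D : C * C) : C * C :=
  (theta1 / theta2 * fst D,
   - (theta2 / theta1 * snd D + theta3 ^ 2 / (theta1 * theta2) * m * fst D))%C.

Definition resonator_data (theta2 theta3 m : R) (D : C * C) : C * C :=
  (theta3 / theta2 * fst D, m * (theta3 / theta2 * fst D))%C.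

Lemma vertex_rel_cross (theta1 theta2 theta3 m : R) (D : C * C) :
  0 < theta1 -> 0 < theta2 -> 0 < theta3 ->
  vertex_rel theta1 theta2 theta3 (cross theta1 theta2 theta3 m D) D
    (resonator_data theta2 theta3 m D).
Proof.
  intros H1 H2 H3.
  assert (theta1 <> 0 /\ theta2 <> 0 /\ theta3 <> 0) as (N1 & N2 & N3) by lra.
  apply RtoC_neq_0 in N1, N2, N3.
  unfold vertex_rel, cross, resonator_data; simpl fst; simpl snd.
  repeat split; field; auto.
Qed.

Lemma vertex_rel_cross_inv (theta1 theta2 theta3 m : R) (L D W : C * C) :
  0 < theta1 -> 0 < theta2 -> 0 < theta3 ->
  vertex_rel theta1 theta2 theta3 L D W -> snd W = (m * fst W)%C ->
  L = cross theta1 theta2 theta3 m D.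
Proof.
  intros H1 H2 H3 (E1 & E2 & E3) EW.
  assert (theta1 <> 0 /\ theta2 <> 0 /\ theta3 <> 0) as (N1 & N2 & N3) by lra.
  apply RtoC_neq_0 in N1, N2, N3.
  assert (F1 : fst L = (theta1 / theta2 * fst D)%C).
  { transitivity (theta1 * (fst L / theta1))%C; [ field; auto | ].
    rewrite E1. field; auto. }
  assert (F3 : fst W = (theta3 / theta2 * fst D)%C).
  { transitivity (theta3 * (fst W / theta3))%C; [ field; auto | ].
    rewrite <- E2. field; auto. }
  rewrite EW, F3 in E3.
  unfold cross. destruct L as [L1 L2]; simpl in F1, E3. f_equal; auto.
  transitivity ((theta1 * L2 + theta2 * snd D
     + theta3 * (m * (theta3 / theta2 * fst D))
     - (theta2 * snd D + theta3 * (m * (theta3 / theta2 * fst D)))) / theta1)%C.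
  - field; auto.
  - rewrite E3. field; auto.
Qed.

Lemma endpoint_rel_mu (l alpha beta k : R) (W : C * C) :
  mu_den l alpha beta k <> 0 ->
  endpoint_rel l alpha beta k W <-> snd W = (mu l alpha beta k * fst W)%C.
Proof.
  intros Hden. unfold endpoint_rel.
  change (mu l alpha beta k) with (mu_num l alpha beta k / mu_den l alpha beta k).
  assert (Hc := RtoC_neq_0 _ Hden). rewrite RtoC_div by auto.
  split; intros E.
  - transitivity ((mu_den l alpha beta k * snd W) / mu_den l alpha beta k)%C;
      [ field; auto | rewrite E; field; auto ].
  - rewrite E. field; auto.
Qed.

(** The amplitudes to the right of the [n]-th vertex counted from the last one,
    when the outgoing wave has the value [tau] at the last vertex. *)
Fixpoint back_data (k h theta1 theta2 theta3 m : R) (tau : C) (n : nat) : C * C :=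
  match n with
  | O => (tau, Ci * tau)%C
  | S i => far_end k h
             (cross theta1 theta2 theta3 m (back_data k h theta1 theta2 theta3 m tau i))
  end.

(** Half the trace of the transfer matrix of one period: the cosine of the Bloch
    phase of the infinite periodic chain. *)
Definition bloch_cos (k h theta1 theta2 theta3 m : R) : R :=
  (theta1 ^ 2 + theta2 ^ 2) / (2 * theta1 * theta2) * cos (k * h)
  - theta3 ^ 2 / (2 * theta1 * theta2) * m * sin (k * h).

Lemma Ci_square : (Ci * Ci = - 1)%C.
Proof. apply injective_projections; simpl; ring. Qed.

Lemma expi_Ci (x : R) : expi x = (cos x + Ci * sin x)%C.
Proof. apply injective_projections; simpl; ring. Qed.

(** By Cayley-Hamilton, the amplitudes to the left of successive vertices satisfy
    the Chebyshev recurrence.  They are [U_n] times the data at the last vertex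
    minus [U_{n-1}] times the data one period beyond it, where the outgoing wave
    has the value [tau exp(ikh)]. *)
Lemma cross_back_data (k h theta1 theta2 theta3 m : R) (tau : C) (n : nat) :
  0 < theta1 -> 0 < theta2 -> 0 < theta3 ->
  let xi := bloch_cos k h theta1 theta2 theta3 m in
  let U := chebyshevU n xi in
  let V := chebyshevU_pred n xi in
  cross theta1 theta2 theta3 m (back_data k h theta1 theta2 theta3 m tau n)
  = (tau * (U * (theta1 / theta2) - V * expi (k * h)),
     - (tau * (U * (theta3 ^ 2 / (theta1 * theta2) * m + Ci * (theta2 / theta1))
               - V * (Ci * expi (k * h)))))%C.
Proof.
  intros H1 H2 H3 xi. subst xi.
  set (xi := bloch_cos k h theta1 theta2 theta3 m).
  assert (theta1 <> 0 /\ theta2 <> 0) as (N1 & N2) by lra.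
  assert (C1 := RtoC_neq_0 _ N1). assert (C2 := RtoC_neq_0 _ N2).
  assert (Hxi : (2 * xi = (theta1 / theta2 + theta2 / theta1) * cos (k * h)
     - theta3 ^ 2 / (theta1 * theta2) * m * sin (k * h))%C).
  { rewrite <- RtoC_pow, <- !RtoC_mult, <- !RtoC_div by
      (try apply Rmult_integral_contrapositive; auto).
    rewrite <- !RtoC_plus, <- !RtoC_mult, <- RtoC_minus. f_equal.
    unfold xi, bloch_cos. field; auto. }
  assert (Haa : (theta1 / theta2 * (theta2 / theta1) = 1)%C) by (field; auto).
  assert (Hcs := RtoC_sin_square (k * h)).
  rewrite !expi_Ci.
  assert (Hi := Ci_square).
  remember (theta3 ^ 2 / (theta1 * theta2))%C as b eqn:Hb.
  set (a := (theta1 / theta2)%C) in *. set (a' := (theta2 / theta1)%C) in *.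
  set (c := RtoC (cos (k * h))) in *. set (s := RtoC (sin (k * h))) in *.
  induction n as [ | n IH ].
  - simpl chebyshevU; simpl chebyshevU_pred. unfold cross; simpl fst; simpl snd.
    fold a a'. rewrite <- Hb.
    f_equal; ring.
  - simpl back_data. rewrite IH. clear IH.
    cbv zeta. simpl chebyshevU_pred. rewrite chebyshevU_S.
    unfold cross, far_end; simpl fst; simpl snd. fold a a' c s. rewrite <- Hb.
    rewrite RtoC_minus, !RtoC_mult, Hxi.
    f_equal; ring [Haa Hcs Hi].
Qed.

(** The reciprocal of the outgoing value at the last vertex, for an incoming wave
    of unit amplitude and a chain of [n + 1] resonators. *)
Definition inverse_amplitude (n : nat) (k h theta1 theta2 theta3 m : R) : C :=
  let xi := bloch_cos k h theta1 theta2 theta3 m in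
  (chebyshevU n xi * ((theta1 ^ 2 + theta2 ^ 2) / (2 * theta1 * theta2)
                      - Ci * (theta3 ^ 2 / (2 * theta1 * theta2) * m))
   - chebyshevU_pred n xi * expi (k * h))%C.

(** The combination [fst L + Ci * snd L] cancels the reflected wave: it equals [2]
    for the amplitudes [(1 + r, Ci (r - 1))] of the incoming lead. *)
Lemma incoming_back_data (k h theta1 theta2 theta3 m : R) (tau : C) (n : nat) :
  0 < theta1 -> 0 < theta2 -> 0 < theta3 ->
  let L := cross theta1 theta2 theta3 m (back_data k h theta1 theta2 theta3 m tau n) in
  (fst L + Ci * snd L = 2 * (tau * inverse_amplitude n k h theta1 theta2 theta3 m))%C.
Proof.
  intros H1 H2 H3. cbv zeta. rewrite cross_back_data by auto.
  unfold inverse_amplitude; simpl fst; simpl snd.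
  assert (theta1 <> 0 /\ theta2 <> 0) as (N1 & N2) by lra.
  assert (C1 := RtoC_neq_0 _ N1). assert (C2 := RtoC_neq_0 _ N2).
  assert (C3 : RtoC 2 <> 0%C) by (apply RtoC_neq_0; lra).
  field [Ci_square]; auto.
Qed.

Lemma Cmod_inverse_amplitude (n : nat) (k h theta1 theta2 theta3 m : R) :
  0 < theta1 -> 0 < theta2 -> 0 < theta3 ->
  let A := (theta1 ^ 2 + theta2 ^ 2) / (2 * theta1 * theta2) in
  let B := theta3 ^ 2 / (2 * theta1 * theta2) in
  Cmod (inverse_amplitude n k h theta1 theta2 theta3 m) ^ 2
  = 1 + (A ^ 2 - 1 + B ^ 2 * m ^ 2)
        * chebyshevU n (bloch_cos k h theta1 theta2 theta3 m) ^ 2.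
Proof.
  intros H1 H2 H3 A B.
  assert (Hxi : bloch_cos k h theta1 theta2 theta3 m
                = A * cos (k * h) - B * m * sin (k * h)) by reflexivity.
  unfold inverse_amplitude.
  set (xi := bloch_cos k h theta1 theta2 theta3 m) in *. cbv zeta.
  assert (E := chebyshevU_invariant n xi).
  set (U := chebyshevU n xi) in *. set (V := chebyshevU_pred n xi) in *.
  assert (HA : ((theta1 ^ 2 + theta2 ^ 2) / (2 * theta1 * theta2))%C = RtoC A).
  { unfold A. rewrite RtoC_div, RtoC_plus, !RtoC_mult, !RtoC_pow; auto. nra. }
  assert (HB : (theta3 ^ 2 / (2 * theta1 * theta2))%C = RtoC B).
  { unfold B. rewrite RtoC_div, !RtoC_mult, !RtoC_pow; auto. nra. }
  rewrite HA, HB.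
  unfold Cmod. rewrite pow2_sqrt by nra. unfold expi. simpl.
  assert (Hcs : (sin (k * h)) * sin (k * h) = 1 - cos (k * h) * cos (k * h)).
  { generalize (sin2_cos2 (k * h)); unfold Rsqr; lra. }
  set (c := cos (k * h)) in *. set (s := sin (k * h)) in *.
  transitivity (U ^ 2 * (A ^ 2 + B ^ 2 * m ^ 2 - 1)
    + (U ^ 2 - 2 * (A * c - B * m * s) * U * V + V ^ 2)).
  - ring [Hcs].
  - rewrite <- Hxi, E. ring.
Qed.

(** This is the bound [1 <= A] on which the positivity of [1 / T] and of
    [U_{N-1}(A + B h / phi')] rests. *)
Lemma mean_ratio_ge_1 (x y : R) :
  0 < x -> 0 < y -> 1 <= (x ^ 2 + y ^ 2) / (2 * x * y).
Proof.
  intros Hx Hy.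
  replace ((x ^ 2 + y ^ 2) / (2 * x * y)) with (1 + (x - y) ^ 2 / (2 * x * y))
    by (field; lra).
  assert (0 <= (x - y) ^ 2 / (2 * x * y)); [ | lra ].
  apply Rle_mult_inv_pos; [ apply pow2_ge_0 | nra ].
Qed.

Lemma inverse_transmission_ge_1 (theta1 theta2 B m u : R) :
  0 < theta1 -> 0 < theta2 ->
  let A := (theta1 ^ 2 + theta2 ^ 2) / (2 * theta1 * theta2) in
  1 <= 1 + (A ^ 2 - 1 + B ^ 2 * m ^ 2) * u ^ 2.
Proof.
  intros H1 H2 A.
  assert (HA : 1 <= A) by (apply mean_ratio_ge_1; auto).
  assert (0 <= (A ^ 2 - 1 + B ^ 2 * m ^ 2) * u ^ 2); [ | lra ].
  apply Rmult_le_pos; [ | apply pow2_ge_0 ].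
  generalize (pow2_ge_0 (B * m)). rewrite Rpow_mult_distr. nra.
Qed.

Lemma inverse_amplitude_neq_0 (n : nat) (k h theta1 theta2 theta3 m : R) :
  0 < theta1 -> 0 < theta2 -> 0 < theta3 ->
  inverse_amplitude n k h theta1 theta2 theta3 m <> 0%C.
Proof.
  intros H1 H2 H3 E.
  assert (M := Cmod_inverse_amplitude n k h theta1 theta2 theta3 m H1 H2 H3).
  cbv zeta in M. rewrite E, Cmod_0 in M.
  assert (G := inverse_transmission_ge_1 theta1 theta2 (theta3 ^ 2 / (2 * theta1 * theta2))
    m (chebyshevU n (bloch_cos k h theta1 theta2 theta3 m)) H1 H2).
  cbv zeta in G. lra.
Qed.

(** The outgoing value determines all amplitudes from the last vertex backwards,
    and the incoming wave determines the outgoing value. *)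
Lemma discrete_transmission (N : nat)
    (h l theta1 theta2 theta3 alpha beta k : R)
    (L D W : nat -> C * C) (r t : C) :
  (1 <= N)%nat -> 0 < theta1 -> 0 < theta2 -> 0 < theta3 ->
  mu_den l alpha beta k <> 0 ->
  discrete_solution N h l theta1 theta2 theta3 alpha beta k L D W r t ->
  (t * expi (k * vertex h (N - 1))
   * inverse_amplitude (N - 1) k h theta1 theta2 theta3 (mu l alpha beta k) = 1)%C.
Proof.
  intros HN H1 H2 H3 Hden (HL0 & HLS & HD & Hrel).
  set (m := mu l alpha beta k) in *.
  set (tau := (t * expi (k * vertex h (N - 1)))%C) in *.
  assert (HL : forall j, (j < N)%nat -> L j = cross theta1 theta2 theta3 m (D j)).
  { intros j Hj. destruct (Hrel j Hj) as [Hv He].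
    apply endpoint_rel_mu in He; auto.
    eapply vertex_rel_cross_inv; eauto. }
  assert (HDn : forall n, (n < N)%nat ->
            D (N - 1 - n)%nat = back_data k h theta1 theta2 theta3 m tau n).
  { induction n as [ | n IH ]; intros Hn.
    - rewrite Nat.sub_0_r. exact HD.
    - simpl. rewrite <- IH, <- HL by lia.
      replace (N - 1 - n)%nat with (S (N - 1 - S n)) by lia.
      rewrite HLS by lia.
      symmetry; apply far_end_involutive. }
  assert (E := incoming_back_data k h theta1 theta2 theta3 m tau (N - 1) H1 H2 H3).
  cbv zeta in E.
  rewrite <- HDn in E by lia.
  replace (N - 1 - (N - 1))%nat with 0%nat in E by lia.
  rewrite <- HL, HL0 in E by lia. simpl fst in E; simpl snd in E.
  assert (C3 : RtoC 2 <> 0%C) by (apply RtoC_neq_0; lra).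
  transitivity (2 * (tau * inverse_amplitude (N - 1) k h theta1 theta2 theta3 m) / 2)%C;
    [ field; auto | ].
  rewrite <- E. field [Ci_square]; auto.
Qed.

Lemma discrete_existence (N : nat)
    (h l theta1 theta2 theta3 alpha beta k : R) :
  (1 <= N)%nat -> 0 < theta1 -> 0 < theta2 -> 0 < theta3 ->
  mu_den l alpha beta k <> 0 ->
  exists (L D W : nat -> C * C) (r t : C),
    discrete_solution N h l theta1 theta2 theta3 alpha beta k L D W r t.
Proof.
  intros HN H1 H2 H3 Hden.
  set (m := mu l alpha beta k).
  assert (Hinv := inverse_amplitude_neq_0 (N - 1) k h theta1 theta2 theta3 m H1 H2 H3).
  assert (Hinc := incoming_back_data k h theta1 theta2 theta3 m
     (/ inverse_amplitude (N - 1) k h theta1 theta2 theta3 m)%C (N - 1) H1 H2 H3).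
  cbv zeta in Hinc. rewrite Cinv_l in Hinc by auto.
  set (tau := (/ inverse_amplitude (N - 1) k h theta1 theta2 theta3 m)%C) in *.
  set (D := fun j => back_data k h theta1 theta2 theta3 m tau (N - 1 - j)).
  set (L := fun j => cross theta1 theta2 theta3 m (D j)).
  exists L, D, (fun j => resonator_data theta2 theta3 m (D j)),
    (fst (L 0%nat) - 1)%C, (tau * expi (- (k * vertex h (N - 1))))%C.
  assert (Htau : (tau * expi (- (k * vertex h (N - 1))) * expi (k * vertex h (N - 1)) = tau)%C).
  { rewrite <- Cmult_assoc, <- expi_add, Rplus_opp_l. unfold expi.
    rewrite cos_0, sin_0. apply Cmult_1_r. }
  split; [ | split; [ | split ]].
  - unfold L, D. rewrite Nat.sub_0_r.
    set (X := cross _ _ _ _ _) in *. destruct X as [X1 X2].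
    simpl fst in *; simpl snd in *. f_equal; [ ring | ].
    transitivity (- (Ci * ((X1 + Ci * X2) - X1)))%C; [ ring [Ci_square] | ].
    rewrite Hinc. ring.
  - intros j Hj. unfold L, D.
    replace (N - 1 - j)%nat with (S (N - 1 - S j)) by lia. simpl back_data.
    symmetry; apply far_end_involutive.
  - unfold D. rewrite Nat.sub_diag, Htau. reflexivity.
  - intros j Hj. split.
    + apply vertex_rel_cross; auto.
    + apply endpoint_rel_mu; auto.
Qed.

(** One solution of the algebraic problem, with any transmission amplitude, is
    enough for [epsilon] to pick an amplitude that belongs to some solution. *)
Lemma amplitude_spec (N : nat) (h l theta1 theta2 theta3 alpha beta k : R)
    (L D W : nat -> C * C) (r t : C) :
  (1 <= N)%nat -> 0 < h -> 0 < l -> 0 < k ->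
  discrete_solution N h l theta1 theta2 theta3 alpha beta k L D W r t ->
  exists (L' D' W' : nat -> C * C) (r' : C),
    discrete_solution N h l theta1 theta2 theta3 alpha beta k L' D' W' r'
      (transmission_amplitude N h l theta1 theta2 theta3 alpha beta k).
Proof.
  intros HN Hh Hl Hk Hd.
  destruct (discrete_scattering _ _ _ _ _ _ _ _ _ _ _ _ _ _ HN Hh Hl Hk Hd) as [psi Hpsi].
  destruct (epsilon_spec (inhabits (RtoC 0)) (fun t : C =>
    exists (psi : graph_fun) (r : C),
      scattering_solution N h l theta1 theta2 theta3 alpha beta k psi r t))
    as (psi' & r' & H').
  { exists t, psi, r; exact Hpsi. }
  apply scattering_discrete in H' as (L' & D' & W' & H'); auto.
  exists L', D', W', r'. exact H'.
Qed.

Lemma transmission_formula (N : nat) (h l theta1 theta2 theta3 alpha beta k : R) :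
  (1 <= N)%nat -> 0 < h -> 0 < l -> 0 < k ->
  0 < theta1 -> 0 < theta2 -> 0 < theta3 ->
  mu_den l alpha beta k <> 0 ->
  let A := (theta1 ^ 2 + theta2 ^ 2) / (2 * theta1 * theta2) in
  let B := theta3 ^ 2 / (2 * theta1 * theta2) in
  let m := mu l alpha beta k in
  transmission_probability N h l theta1 theta2 theta3 alpha beta k
  = / (1 + (A ^ 2 - 1 + B ^ 2 * m ^ 2)
           * chebyshevU (N - 1) (A * cos (k * h) - B * m * sin (k * h)) ^ 2).
Proof.
  intros HN Hh Hl Hk H1 H2 H3 Hden A B m.
  destruct (discrete_existence N h l theta1 theta2 theta3 alpha beta k HN H1 H2 H3 Hden)
    as (L0 & D0 & W0 & r0 & t0 & H0).
  apply amplitude_spec in H0 as (L & D & W & r & Hd); auto.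
  apply discrete_transmission in Hd; auto.
  unfold transmission_probability.
  set (t := transmission_amplitude N h l theta1 theta2 theta3 alpha beta k) in *.
  assert (M := Cmod_inverse_amplitude (N - 1) k h theta1 theta2 theta3 m H1 H2 H3).
  cbv zeta in M. fold A B in M.
  change (bloch_cos k h theta1 theta2 theta3 m)
    with (A * cos (k * h) - B * m * sin (k * h)) in M.
  rewrite <- M.
  fold m in Hd.
  apply (f_equal Cmod) in Hd. rewrite !Cmod_mult, Cmod_expi, Cmod_1, Rmult_1_r in Hd.
  set (z := Cmod (inverse_amplitude _ _ _ _ _ _ _)) in *.
  assert (z <> 0) by (intros Z; rewrite Z in Hd; lra).
  apply Rmult_eq_reg_r with (z ^ 2); [ | apply pow_nonzero; auto ].
  rewrite Rinv_l by (apply pow_nonzero; auto).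
  rewrite <- Rpow_mult_distr, Hd. ring.
Qed.

(** At a zero of [mu_den] the endpoint condition leaves the derivative of the
    resonator wave free and makes its value at the vertex zero, which cuts the
    channel.  The explicit solution below reflects the incoming wave with
    [r = -1] and is nonzero only on the incoming lead and the first resonator. *)
Lemma transmission_zero (N : nat) (h l theta1 theta2 theta3 alpha beta k : R) :
  (1 <= N)%nat -> 0 < h -> 0 < l -> 0 < k ->
  0 < theta1 -> 0 < theta2 -> 0 < theta3 -> (alpha, beta) <> (0, 0) ->
  mu_den l alpha beta k = 0 ->
  transmission_probability N h l theta1 theta2 theta3 alpha beta k = 0.
Proof.
  intros HN Hh Hl Hk H1 H2 H3 Hab Hden.
  assert (theta1 <> 0 /\ theta2 <> 0 /\ theta3 <> 0) as (N1 & N2 & N3) by lra.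
  apply RtoC_neq_0 in N1, N2, N3.
  assert (H0 : discrete_solution N h l theta1 theta2 theta3 alpha beta k
    (fun j => match j with O => (RtoC 0, - (2 * Ci))%C | _ => (RtoC 0, RtoC 0) end)
    (fun _ => (RtoC 0, RtoC 0))
    (fun j => match j with
              | O => (RtoC 0, theta1 / theta3 * (2 * Ci))%C
              | _ => (RtoC 0, RtoC 0) end) (- 1)%C 0).
  { split; [ | split; [ | split ]].
    - f_equal; ring.
    - intros j _. unfold far_end; simpl fst; simpl snd. f_equal; ring.
    - f_equal; ring.
    - intros j _. unfold vertex_rel, endpoint_rel. rewrite Hden.
      destruct j; simpl fst; simpl snd; repeat split; try (field; auto); ring. }
  apply amplitude_spec in H0 as (L & D & W & r & (_ & _ & HD & Hrel)); auto.
  destruct (Hrel (N - 1)%nat) as [(_ & E2 & _) He]; [ lia | ].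
  unfold endpoint_rel in He. rewrite Hden in He.
  assert (Hnum := RtoC_neq_0 _ (mu_num_neq_0 l alpha beta k Hab Hk Hden)).
  assert (W0 : fst (W (N - 1)%nat) = 0%C).
  { transitivity (RtoC (mu_num l alpha beta k) * fst (W (N - 1)%nat) / mu_num l alpha beta k)%C;
      [ field; auto | ].
    rewrite <- He. field; auto. }
  assert (D0 : fst (D (N - 1)%nat) = 0%C).
  { transitivity (theta2 * (fst (D (N - 1)%nat) / theta2))%C; [ field; auto | ].
    rewrite E2, W0. field; auto. }
  rewrite HD in D0. simpl fst in D0.
  unfold transmission_probability.
  set (t := transmission_amplitude N h l theta1 theta2 theta3 alpha beta k) in *.
  apply (f_equal Cmod) in D0. rewrite Cmod_mult, Cmod_0 in D0.
  rewrite Cmod_expi, Rmult_1_r in D0. rewrite D0. ring.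
Qed.

(** * Finite limits *)

Lemma is_lim_mult_finite (f g : R -> R) (x a b : R) :
  is_lim f x a -> is_lim g x b -> is_lim (fun y => f y * g y) x (a * b).
Proof. intros Hf Hg. apply (is_lim_mult f g x a b Hf Hg). exact I. Qed.

Lemma is_lim_pow_finite (f : R -> R) (x a : R) (n : nat) :
  is_lim f x a -> is_lim (fun y => f y ^ n) x (a ^ n).
Proof.
  intros Hf. induction n as [ | n IH ]; simpl.
  - apply is_lim_const.
  - apply is_lim_mult_finite; auto.
Qed.

Lemma is_lim_inv_finite (f : R -> R) (x a : R) :
  a <> 0 -> is_lim f x a -> is_lim (fun y => / f y) x (/ a).
Proof.
  intros Ha Hf. apply (is_lim_inv f x a Hf).
  intros E. apply Ha. injection E; auto.
Qed.

Lemma is_lim_shift (x : R) : is_lim (fun y => y - x) x 0.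
Proof.
  assert (H := is_lim_minus' _ _ x x x (is_lim_id x) (is_lim_const x x)).
  rewrite Rminus_diag in H. exact H.
Qed.

Lemma is_lim_is_derive (f : R -> R) (x d : R) :
  is_derive f x d -> is_lim f x (f x).
Proof.
  intros H. apply is_lim_continuity. apply derivable_continuous_pt.
  exists d. apply is_derive_Reals, H.
Qed.

Lemma is_lim_difference_quotient (f : R -> R) (x d : R) :
  is_derive f x d -> is_lim (fun y => (f y - f x) / (y - x)) x d.
Proof.
  intros H. apply is_derive_Reals in H. apply is_lim_spec. intros eps.
  destruct (H eps (cond_pos eps)) as [delta Hd].
  exists delta. intros y Hy Hne.
  specialize (Hd (y - x)). replace (x + (y - x)) with y in Hd by (symmetry; apply Rplus_minus).
  apply Hd; [ | exact Hy ].
  intros E. apply Hne, Rminus_diag_uniq, E.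
Qed.

Lemma is_lim_neq_0 (f : R -> R) (x a : R) :
  a <> 0 -> is_lim f x a -> locally' x (fun y => f y <> 0).
Proof.
  intros Ha Hf. apply is_lim_spec in Hf.
  assert (Hpos : 0 < Rabs a) by (apply Rabs_pos_lt; auto).
  specialize (Hf (mkposreal _ Hpos)).
  revert Hf. apply filter_imp. simpl. intros y Hy E. rewrite E in Hy.
  replace (0 - a) with (- a) in Hy by ring. rewrite Rabs_Ropp in Hy. lra.
Qed.

Lemma locally'_neq (x : R) : locally' x (fun y => y <> x).
Proof. exists (mkposreal 1 Rlt_0_1). intros y _ H; exact H. Qed.

Lemma locally'_pos (x : R) : 0 < x -> locally' x (fun y => 0 < y).
Proof.
  intros Hx. apply (filter_le_within (F := locally x)).
  exact (open_gt 0 x Hx).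
Qed.

(** * The resonator phase at a pole *)

(** One formula covers the three cases in the definition of the phase shift. *)
Lemma is_derive_resonator_phase (l alpha beta k : R) :
  (alpha, beta) <> (0, 0) -> 0 < k ->
  is_derive (resonator_phase l alpha beta) k
    (l + alpha * beta / ((beta * k) ^ 2 + alpha ^ 2)).
Proof.
  intros Hab Hk. unfold resonator_phase, phase_shift.
  destruct (Req_EM_T alpha 0) as [Ha | Ha].
  { auto_derive; auto. rewrite Ha. unfold Rdiv; ring. }
  destruct (Req_EM_T beta 0) as [Hb | Hb].
  { auto_derive; auto. rewrite Hb. unfold Rdiv; ring. }
  assert (beta * k <> 0) by (apply Rmult_integral_contrapositive; split; lra).
  auto_derive; auto.
  field. repeat split; auto; [ | lra ].
  generalize (pow2_ge_0 (beta * k)) (pow2_gt_0 alpha Ha). lra.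
Qed.

Lemma is_derive_mu_den (l alpha beta k : R) :
  is_derive (mu_den l alpha beta) k (beta * cos (k * l) - l * mu_num l alpha beta k).
Proof. unfold mu_den, mu_num. auto_derive; auto. ring. Qed.

Lemma is_lim_mu_num (l alpha beta kappa : R) :
  is_lim (mu_num l alpha beta) kappa (mu_num l alpha beta kappa).
Proof.
  apply is_lim_continuity. unfold mu_num. apply derivable_continuous_pt.
  apply ex_derive_Reals_0. auto_derive; auto.
Qed.

(** The inverse of the rotation in [mu_num_den], at a point where one coordinate
    of the rotated vector is zero. *)
Lemma coefficients_at_pole (l alpha beta k : R) :
  mu_den l alpha beta k = 0 ->
  alpha = - (mu_num l alpha beta k * cos (k * l)) /\
  beta * k = mu_num l alpha beta k * sin (k * l).
Proof.
  intros Hden. assert (Hsc := sin2_cos2 (k * l)).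
  split.
  - transitivity (- (mu_num l alpha beta k * cos (k * l))
                  + mu_den l alpha beta k * sin (k * l)); [ | rewrite Hden; ring ].
    transitivity (alpha * ((sin (k * l))² + (cos (k * l))²)).
    + rewrite Hsc; ring.
    + unfold mu_num, mu_den, Rsqr; ring.
  - transitivity (mu_num l alpha beta k * sin (k * l)
                  + mu_den l alpha beta k * cos (k * l)); [ | rewrite Hden; ring ].
    transitivity (beta * k * ((sin (k * l))² + (cos (k * l))²)).
    + rewrite Hsc; ring.
    + unfold mu_num, mu_den, Rsqr; ring.
Qed.

Lemma phase_derive_at_pole (l alpha beta k : R) :
  (alpha, beta) <> (0, 0) -> 0 < k -> mu_den l alpha beta k = 0 ->
  Derive (resonator_phase l alpha beta) k = l - sin (k * l) * cos (k * l) / k.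
Proof.
  intros Hab Hk Hden.
  rewrite (is_derive_unique _ _ _ (is_derive_resonator_phase l alpha beta k Hab Hk)).
  assert (Hn := mu_num_neq_0 l alpha beta k Hab Hk Hden).
  assert (E := mu_num_den l alpha beta k). rewrite Hden in E.
  replace ((beta * k) ^ 2 + alpha ^ 2) with (mu_num l alpha beta k ^ 2) by lra.
  destruct (coefficients_at_pole l alpha beta k Hden) as [Ha Hb].
  set (n := mu_num l alpha beta k) in *.
  replace (alpha * beta) with (alpha * (beta * k) / k) by (field; lra).
  rewrite Hb, Ha. field; split; auto; lra.
Qed.

(** The left side is the derivative of [mu_den] ([is_derive_mu_den]); the equation
    is what makes [- 1 / phi'] the residue of [mu]. *)
Lemma mu_den_derive_at_pole (l alpha beta k : R) :
  (alpha, beta) <> (0, 0) -> 0 < k -> mu_den l alpha beta k = 0 ->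
  beta * cos (k * l) - l * mu_num l alpha beta k
  = - (mu_num l alpha beta k * Derive (resonator_phase l alpha beta) k).
Proof.
  intros Hab Hk Hden. rewrite phase_derive_at_pole by auto.
  destruct (coefficients_at_pole l alpha beta k Hden) as [_ Hb].
  set (n := mu_num l alpha beta k) in *.
  replace (beta * cos (k * l)) with (beta * k * cos (k * l) / k) by (field; lra).
  rewrite Hb. field; lra.
Qed.

(** With [y = k l], the formula of [phase_derive_at_pole] reads
    [k phi' = y - sin (2 y) / 2], and [sin z < z] for [z > 0]. *)
Lemma phase_derive_pos (l alpha beta k : R) :
  (alpha, beta) <> (0, 0) -> 0 < l -> 0 < k -> mu_den l alpha beta k = 0 ->
  0 < Derive (resonator_phase l alpha beta) k.
Proof.
  intros Hab Hl Hk Hden. rewrite phase_derive_at_pole by auto.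
  assert (Hkl : 0 < k * l) by (apply Rmult_lt_0_compat; auto).
  assert (S2 := sin_lt_x (2 * (k * l)) ltac:(lra)). rewrite sin_2a in S2.
  apply Rmult_lt_reg_l with k; auto. rewrite Rmult_0_r.
  replace (k * (l - sin (k * l) * cos (k * l) / k))
    with (k * l - sin (k * l) * cos (k * l)) by (field; lra).
  lra.
Qed.

(** A zero of [mu_den] is simple, because its derivative there is
    [- mu_num phi']. *)
Lemma mu_den_neq_0_near (l alpha beta kappa : R) :
  (alpha, beta) <> (0, 0) -> 0 < l -> 0 < kappa -> mu_den l alpha beta kappa = 0 ->
  locally' kappa (fun k => mu_den l alpha beta k <> 0).
Proof.
  intros Hab Hl Hk Hden.
  assert (Hn := mu_num_neq_0 l alpha beta kappa Hab Hk Hden).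
  assert (Hp := phase_derive_pos l alpha beta kappa Hab Hl Hk Hden).
  assert (Hq := is_lim_difference_quotient _ _ _ (is_derive_mu_den l alpha beta kappa)).
  rewrite mu_den_derive_at_pole, Hden in Hq by auto.
  apply is_lim_neq_0 in Hq.
  - revert Hq. apply filter_imp. intros k Hq E. apply Hq. rewrite E.
    unfold Rdiv; ring.
  - apply Ropp_neq_0_compat, Rmult_integral_contrapositive; split; lra.
Qed.

Lemma mu_residue (l alpha beta kappa : R) :
  (alpha, beta) <> (0, 0) -> 0 < l -> 0 < kappa -> mu_den l alpha beta kappa = 0 ->
  is_lim (fun k => (k - kappa) * mu l alpha beta k) kappa
    (- / Derive (resonator_phase l alpha beta) kappa).
Proof.
  intros Hab Hl Hk Hden.
  assert (Hn := mu_num_neq_0 l alpha beta kappa Hab Hk Hden).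
  assert (Hp := phase_derive_pos l alpha beta kappa Hab Hl Hk Hden).
  assert (Hq := is_lim_difference_quotient _ _ _ (is_derive_mu_den l alpha beta kappa)).
  rewrite mu_den_derive_at_pole, Hden in Hq by auto.
  set (p := Derive (resonator_phase l alpha beta) kappa) in *.
  apply is_lim_inv_finite in Hq;
    [ | apply Ropp_neq_0_compat, Rmult_integral_contrapositive; split; lra ].
  assert (Hnum := is_lim_mu_num l alpha beta kappa).
  assert (H := is_lim_mult_finite _ _ _ _ _ Hnum Hq).
  replace (- / p) with (mu_num l alpha beta kappa * / - (mu_num l alpha beta kappa * p))
    by (field; lra).
  revert H. apply is_lim_ext_loc.
  generalize (locally'_neq kappa) (mu_den_neq_0_near l alpha beta kappa Hab Hl Hk Hden).
  intros G1 G2. generalize (filter_and _ _ G1 G2). apply filter_imp.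
  intros k [Hne Hd].
  change (mu l alpha beta k) with (mu_num l alpha beta k / mu_den l alpha beta k).
  field. split; auto. lra.
Qed.

Lemma is_pole_mu_iff (l alpha beta kappa : R) :
  (alpha, beta) <> (0, 0) -> 0 < l -> 0 < kappa ->
  is_pole (mu l alpha beta) kappa <-> mu_den l alpha beta kappa = 0.
Proof.
  intros Hab Hl Hk. unfold is_pole. split.
  - intros Hpole. destruct (Req_dec (mu_den l alpha beta kappa) 0) as [E | Hden]; auto.
    assert (Hmu : is_lim (mu l alpha beta) kappa (mu l alpha beta kappa)).
    { apply is_lim_continuity, derivable_continuous_pt, ex_derive_Reals_0.
      unfold mu. auto_derive. exact Hden. }
    apply is_lim_Rabs in Hmu.
    apply is_lim_unique in Hmu. apply is_lim_unique in Hpole.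
    rewrite Hpole in Hmu. discriminate.
  - intros Hden.
    assert (Hn := mu_num_neq_0 l alpha beta kappa Hab Hk Hden).
    assert (Hnum := is_lim_mu_num l alpha beta kappa).
    assert (Hd := is_lim_is_derive _ _ _ (is_derive_mu_den l alpha beta kappa)).
    assert (Hinv : is_lim (fun k => Rabs (mu_den l alpha beta k * / mu_num l alpha beta k))
                     kappa 0).
    { replace 0 with (Rabs (mu_den l alpha beta kappa * / mu_num l alpha beta kappa))
        by (rewrite Hden, Rmult_0_l; apply Rabs_R0).
      apply (is_lim_Rabs _ kappa (Finite _)).
      apply is_lim_mult_finite; auto. apply is_lim_inv_finite; auto. }
    assert (near : locally' kappa (fun k =>
              mu_den l alpha beta k <> 0 /\ mu_num l alpha beta k <> 0)).
    { apply filter_and.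
      - apply mu_den_neq_0_near; auto.
      - apply is_lim_neq_0 with (mu_num l alpha beta kappa); auto. }
    apply is_lim_ext_loc with
      (fun k => / Rabs (mu_den l alpha beta k * / mu_num l alpha beta k)).
    + revert near. apply filter_imp. intros k [H1 H2].
      rewrite <- Rabs_inv. f_equal.
      change (mu l alpha beta k) with (mu_num l alpha beta k / mu_den l alpha beta k).
      field; auto.
    + apply is_lim_Rinv_0_right; auto.
      revert near. apply filter_imp. intros k [H1 H2].
      apply Rabs_pos_lt, Rmult_integral_contrapositive; split; auto.
      apply Rinv_neq_0_compat; auto.
Qed.

(** * Chebyshev polynomials along a limit *)

(** Parity of the Chebyshev polynomials, with [c] standing for a sign. *)
Lemma chebyshevU_sign (n : nat) (c x : R) :
  c * c = 1 ->
  chebyshevU n (c * x) = c ^ n * chebyshevU n x /\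
  chebyshevU_pred n (c * x) = c ^ S n * chebyshevU_pred n x.
Proof.
  intros Hc. induction n as [ | n [IH1 IH2] ].
  - simpl; split; ring.
  - split.
    + rewrite !chebyshevU_S, IH1, IH2. simpl; ring.
    + simpl chebyshevU_pred. rewrite IH1. simpl.
      rewrite <- Rmult_assoc, Hc. ring.
Qed.

Lemma chebyshevU_pos (n : nat) (x : R) :
  1 <= x -> 0 <= chebyshevU_pred n x < chebyshevU n x.
Proof.
  intros Hx. induction n as [ | n IH ].
  - simpl; lra.
  - rewrite chebyshevU_S. simpl chebyshevU_pred. nra.
Qed.

Lemma is_lim_chebyshevU (n : nat) (f : R -> R) (kappa x : R) :
  is_lim f kappa x ->
  is_lim (fun k => chebyshevU n (f k)) kappa (chebyshevU n x) /\
  is_lim (fun k => chebyshevU_pred n (f k)) kappa (chebyshevU_pred n x).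
Proof.
  intros Hf. induction n as [ | n [IH1 IH2] ].
  - split; [ exact (is_lim_const 1 kappa) | exact (is_lim_const 0 kappa) ].
  - split; auto. rewrite chebyshevU_S.
    apply is_lim_ext with
      (fun k => 2 * f k * chebyshevU n (f k) - chebyshevU_pred n (f k)).
    { intros k; symmetry; apply chebyshevU_S. }
    apply is_lim_minus'; auto.
    apply is_lim_mult_finite; auto. apply is_lim_mult_finite; auto.
    apply is_lim_const.
Qed.

(** Only the leading term [(2 f)^n] of the polynomial survives the scaling. *)
Lemma is_lim_chebyshevU_scaled (n : nat) (e f : R -> R) (kappa x : R) :
  is_lim e kappa 0 -> is_lim (fun k => e k * f k) kappa x ->
  is_lim (fun k => e k ^ n * chebyshevU n (f k)) kappa ((2 * x) ^ n) /\
  is_lim (fun k => e k ^ n * chebyshevU_pred n (f k)) kappa 0.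
Proof.
  intros He Hf. induction n as [ | n [IH1 IH2] ].
  - split; simpl.
    + apply is_lim_ext with (fun _ => 1); [ intros; ring | apply is_lim_const ].
    + apply is_lim_ext with (fun _ => 0); [ intros; ring | apply is_lim_const ].
  - split.
    + replace ((2 * x) ^ S n) with (2 * x * (2 * x) ^ n - 0 * 0) by (simpl; ring).
      apply is_lim_ext with (fun k => 2 * (e k * f k) * (e k ^ n * chebyshevU n (f k))
        - e k * (e k ^ n * chebyshevU_pred n (f k))).
      { intros k. rewrite chebyshevU_S. simpl; ring. }
      apply is_lim_minus'; repeat apply is_lim_mult_finite; auto.
      apply is_lim_const.
    + replace 0 with (0 * (2 * x) ^ n) by ring.
      apply is_lim_ext with (fun k => e k * (e k ^ n * chebyshevU n (f k))).
      { intros k. simpl; ring. }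
      apply is_lim_mult_finite; auto.
Qed.

(** * Transmission near a pole *)

Lemma asymptotic_of_limit (kappa c : R) (m : nat) (f g : R -> R) :
  c <> 0 -> is_lim (fun k => f k / (k - kappa) ^ m) kappa c ->
  (forall k, g k = c * (k - kappa) ^ m) ->
  asymptotic_at kappa f g /\ vanishing_order f kappa m.
Proof.
  intros Hc Hlim Hg. split.
  - exists (fun k => f k / (k - kappa) ^ m * / c - 1). split.
    + replace 0 with (c * / c - 1) by (field; auto).
      apply is_lim_minus'; [ | apply is_lim_const ].
      apply is_lim_mult_finite; auto. apply is_lim_const.
    + generalize (locally'_neq kappa). apply filter_imp. intros k Hk.
      rewrite Hg. field. split; auto.
      apply pow_nonzero; lra.
  - exists c; auto.
Qed.

Ltac nonzero :=
  unfold Rdiv;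
  repeat first [ assumption | lra | apply pow_nonzero | apply Rinv_neq_0_compat
               | apply Rmult_integral_contrapositive; split ].

Theorem mainTheorem5 :
  forall (N : nat) (h l theta1 theta2 theta3 alpha beta : R),
    (1 <= N)%nat -> 0 < h -> 0 < l ->
    0 < theta1 -> 0 < theta2 -> 0 < theta3 ->
    (alpha, beta) <> (0, 0) ->
    let T := transmission_probability N h l theta1 theta2 theta3 alpha beta in
    let A := (theta1 ^ 2 + theta2 ^ 2) / (2 * theta1 * theta2) in
    let B := theta3 ^ 2 / (2 * theta1 * theta2) in
    let phi' := Derive (resonator_phase l alpha beta) in
    forall kappa : R, 0 < kappa ->
      (is_pole (mu l alpha beta) kappa <-> T kappa = 0) /\
      (is_pole (mu l alpha beta) kappa ->
        (sin (kappa * h) <> 0 ->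
           asymptotic_at kappa T
             (fun k => phi' kappa ^ (2 * N) /
                (4 ^ (N - 1) * B ^ (2 * N) * sin (kappa * h) ^ (2 * (N - 1)))
                * (k - kappa) ^ (2 * N)) /\
           vanishing_order T kappa (2 * N)) /\
        (sin (kappa * h) = 0 ->
           asymptotic_at kappa T
             (fun k => phi' kappa ^ 2 /
                (B ^ 2 * chebyshevU (N - 1) (A + B * h / phi' kappa) ^ 2)
                * (k - kappa) ^ 2) /\
           vanishing_order T kappa 2)).
Proof.
  intros N h l theta1 theta2 theta3 alpha beta HN Hh Hl H1 H2 H3 Hab T A B phi' kappa Hk.
  assert (HT : forall k, 0 < k -> mu_den l alpha beta k <> 0 ->
    T k = / (1 + (A ^ 2 - 1 + B ^ 2 * mu l alpha beta k ^ 2)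
           * chebyshevU (N - 1) (A * cos (k * h) - B * mu l alpha beta k * sin (k * h)) ^ 2))
    by (intros; apply transmission_formula; auto).
  rewrite is_pole_mu_iff by auto.
  split.
  { split.
    - intros Hden. apply transmission_zero; auto.
    - intros HT0. destruct (Req_dec (mu_den l alpha beta kappa) 0) as [E | Hden]; auto.
      exfalso. rewrite HT in HT0 by auto. revert HT0. apply Rinv_neq_0_compat.
      apply Rgt_not_eq, Rlt_le_trans with 1; [ lra | ].
      apply inverse_transmission_ge_1; auto. }
  intros Hden.
  assert (Hp := phase_derive_pos l alpha beta kappa Hab Hl Hk Hden).
  assert (Hres := mu_residue l alpha beta kappa Hab Hl Hk Hden).
  fold phi' in Hp, Hres. set (p := phi' kappa) in *. clearbody p.
  assert (HB : 0 < B).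
  { unfold B. apply Rdiv_lt_0_compat; [ apply pow_lt; auto | nra ]. }
  assert (HA : 1 <= A) by (apply mean_ratio_ge_1; auto).
  assert (near : locally' kappa (fun k => k <> kappa /\ 0 < k /\ mu_den l alpha beta k <> 0)).
  { repeat apply filter_and.
    - apply locally'_neq.
    - apply locally'_pos; auto.
    - apply mu_den_neq_0_near; auto. }
  assert (Heps := is_lim_shift kappa).
  assert (Hcos : is_lim (fun k => cos (k * h)) kappa (cos (kappa * h))).
  { apply (is_lim_is_derive (fun k => cos (k * h)) kappa (- h * sin (kappa * h))).
    auto_derive; auto; ring. }
  assert (Hdsin : is_derive (fun k => sin (k * h)) kappa (h * cos (kappa * h))).
  { auto_derive; auto; ring. }
  assert (Hsin := is_lim_is_derive _ _ _ Hdsin). simpl in Hsin.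
  destruct N as [ | n ]; [ lia | ].
  replace (S n - 1)%nat with n in * by lia.
  (* The factor multiplying [U_{N-1}(xi)^2] in [1 / T], scaled by [(k - kappa)^2]. *)
  assert (Hfac : is_lim (fun k => (k - kappa) ^ 2 * (A ^ 2 - 1)
      + B ^ 2 * ((k - kappa) * mu l alpha beta k) ^ 2) kappa (B ^ 2 * (/ p) ^ 2)).
  { replace (B ^ 2 * (/ p) ^ 2) with (0 ^ 2 * (A ^ 2 - 1) + B ^ 2 * (- / p) ^ 2) by ring.
    apply is_lim_plus'; apply is_lim_mult_finite;
      try apply is_lim_const; apply is_lim_pow_finite; auto. }
  assert (Hps : p <> 0) by lra.
  assert (HBs : B <> 0) by lra.
  clearbody A B.
  split.
  - intros Hs.
    assert (Hxi : is_lim (fun k => (k - kappa) *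
      (A * cos (k * h) - B * mu l alpha beta k * sin (k * h))) kappa
      (B / p * sin (kappa * h))).
    { replace (B / p * sin (kappa * h))
        with (0 * (A * cos (kappa * h)) - B * (- / p) * sin (kappa * h)) by (field; auto).
      apply is_lim_ext with (fun k => (k - kappa) * (A * cos (k * h))
        - B * ((k - kappa) * mu l alpha beta k) * sin (k * h)); [ intros; ring | ].
      apply is_lim_minus'; repeat apply is_lim_mult_finite; auto; apply is_lim_const. }
    (* In the limit of [(k - kappa)^(2N) / T], the summand [(k - kappa)^(2N)] drops
       out and the rest is a product of two scaled limits. *)
    apply asymptotic_of_limit with
      (c := p ^ (2 * S n) / (4 ^ n * B ^ (2 * S n) * sin (kappa * h) ^ (2 * n)));
      [ | | reflexivity ].
    + nonzero.
    + destruct (is_lim_chebyshevU_scaled n _ _ _ _ Heps Hxi) as [HU _].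
      apply (is_lim_pow_finite _ _ _ 2) in HU.
      assert (H := is_lim_plus' _ _ _ _ _ (is_lim_pow_finite _ _ _ (2 * S n) Heps)
                     (is_lim_mult_finite _ _ _ _ _ Hfac HU)).
      rewrite pow_i, Rplus_0_l in H by lia.
      apply is_lim_inv_finite in H.
      * replace (p ^ (2 * S n) / (4 ^ n * B ^ (2 * S n) * sin (kappa * h) ^ (2 * n)))
          with (/ (B ^ 2 * (/ p) ^ 2 * ((2 * (B / p * sin (kappa * h))) ^ n) ^ 2)).
        -- revert H. apply is_lim_ext_loc. revert near. apply filter_imp.
           intros k (Hne & Hk0 & Hd). rewrite HT by auto.
           unfold Rdiv. rewrite <- Rinv_mult. f_equal.
           replace (2 * S n)%nat with (n + n + 2)%nat by lia.
           rewrite !pow_add. ring.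
        -- replace (2 * S n)%nat with (n + n + 2)%nat by lia.
           replace (2 * n)%nat with (n + n)%nat by lia.
           replace 4 with (2 * 2) by ring.
           unfold Rdiv. rewrite !pow_add, !Rpow_mult_distr, !pow_inv.
           field. repeat split; auto; apply pow_nonzero; auto; lra.
      * nonzero.
  - intros Hs.
    set (c := cos (kappa * h)) in *.
    assert (Hc : c * c = 1).
    { generalize (sin2_cos2 (kappa * h)). rewrite Hs. unfold Rsqr, c. lra. }
    assert (HU : 0 < chebyshevU n (A + B * h / p)).
    { assert (0 <= B * h / p) by (apply Rle_mult_inv_pos; nra).
      assert (U := chebyshevU_pos n (A + B * h / p) ltac:(lra)). lra. }
    assert (HUs : chebyshevU n (A + B * h / p) <> 0) by lra.
    assert (Hq := is_lim_difference_quotient _ _ _ Hdsin).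
    assert (Hxi : is_lim (fun k => A * cos (k * h) - B * mu l alpha beta k * sin (k * h))
      kappa (c * (A + B * h / p))).
    { replace (c * (A + B * h / p)) with (A * c - B * (- / p) * (h * c)) by (field; auto).
      apply is_lim_ext_loc with (fun k => A * cos (k * h)
        - B * ((k - kappa) * mu l alpha beta k)
          * ((sin (k * h) - sin (kappa * h)) / (k - kappa))).
      - revert near. apply filter_imp. intros k (Hne & _). rewrite Hs. field. lra.
      - apply is_lim_minus'; apply is_lim_mult_finite; auto; try apply is_lim_const.
        apply is_lim_mult_finite; auto; apply is_lim_const. }
    apply asymptotic_of_limit with
      (c := p ^ 2 / (B ^ 2 * chebyshevU n (A + B * h / p) ^ 2)); [ | | reflexivity ].
    + nonzero.
    + destruct (is_lim_chebyshevU n _ _ _ Hxi) as [HUl _].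
      apply (is_lim_pow_finite _ _ _ 2) in HUl.
      assert (H := is_lim_plus' _ _ _ _ _ (is_lim_pow_finite _ _ _ 2 Heps)
                     (is_lim_mult_finite _ _ _ _ _ Hfac HUl)).
      rewrite (proj1 (chebyshevU_sign n c _ Hc)) in H.
      assert (Hcn : (c ^ n * chebyshevU n (A + B * h / p)) ^ 2
                    = chebyshevU n (A + B * h / p) ^ 2).
      { rewrite Rpow_mult_distr, <- pow_mult, Nat.mul_comm, pow_mult.
        replace (c ^ 2) with 1 by (simpl; lra). rewrite pow1. ring. }
      rewrite Hcn, pow_i, Rplus_0_l in H by lia.
      apply is_lim_inv_finite in H.
      * replace (p ^ 2 / (B ^ 2 * chebyshevU n (A + B * h / p) ^ 2))
          with (/ (B ^ 2 * (/ p) ^ 2 * chebyshevU n (A + B * h / p) ^ 2))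
          by (field; auto).
        revert H. apply is_lim_ext_loc. revert near. apply filter_imp.
        intros k (Hne & Hk0 & Hd). rewrite HT by auto.
        unfold Rdiv. rewrite <- Rinv_mult. f_equal. ring.
      * nonzero.
Qed.
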